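(* Let $d,k\ge 2$ and let $G$ be a $(d,k;+1)$-digraph. For any integer $r\ge 2$, the set of vertices of $G$ with order dividing $r$ induces one of the following: (1) the entire digraph $G$; (2) the empty digraph (no vertices); (3) a pair of vertices that form a transposition in the outlier function $o$; (4) a directed $(k+2)$-cycle; (5) a $(d',k;+1)$-digraph for some $d'$ with $3\le d'\le d-1$.
   Context: Digraphs are finite and without multiple arcs. A digraph $G$ is $k$-geodetic if for any (not necessarily distinct) vertices $u,v$ there is at most one directed walk from $u$ to $v$ of length at most $k$ (walks of length $0$ count, so there are no directed cycles of length at most $k$). Put $M(d,k)=1+d+d^2+\dots+d^k$. A $(d,k;+1)$-digraph is a $k$-geodetic digraph with minimum out-degree $d$ and order $M(d,k)+1$. In such a digraph (with $d,k\ge 2$), for every vertex $u$ there is a unique vertex $o(u)$ with $d(u,o(u))\ge k+1$; $o:V(G)\to V(G)$ is the outlier function. It is known that such $G$ is diregular, that $o$ is an automorphism of $G$, and that there are no $(2,k;+1)$-digraphs for $k\ge 2$. The order of a vertex $u$ is the smallest positive integer $s$ with $o^s(u)=u$. *)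

(* Defs.v *)
From mathcomp Require Import all_boot.
Set Implicit Arguments.
Unset Strict Implicit.
Unset Printing Implicit Defensive.

(* A digraph without multiple arcs is a relation e on a finite vertex type T
   (loops are not excluded a priori).  As there are no multiple arcs, a directed
   walk from u is determined by the sequence p of the vertices that follow u,
   and its length is size p. *)
Definition walk (T : finType) (e : rel T) (u v : T) (p : seq T) : bool :=
  path e u p && (last u p == v).

Definition geodetic (T : finType) (e : rel T) (k : nat) : Prop :=
  forall (u v : T) (p q : seq T),
    walk e u v p -> walk e u v q -> size p <= k -> size q <= k -> p = q.

Definition outdeg (T : finType) (e : rel T) (u : T) : nat := #|[set v | e u v]|.

Definition min_outdeg (T : finType) (e : rel T) (d : nat) : Prop :=
  (forall u, d <= outdeg e u) /\ (exists u, outdeg e u = d).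

Definition moore (d k : nat) : nat := \sum_(i < k.+1) d ^ i.

(* (d,k;+1)-digraphs *)
Definition excess_one (T : finType) (e : rel T) (d k : nat) : Prop :=
  [/\ geodetic e k, min_outdeg e d & #|T| = (moore d k).+1].

(* d(u,v) >= k+1: no walk from u to v has length at most k. *)
Definition far (T : finType) (e : rel T) (k : nat) (u v : T) : bool :=
  ~~ [exists l : 'I_k.+1, exists p : l.-tuple T, walk e u v p].

(* In a (d,k;+1)-digraph with d, k >= 2 exactly one v satisfies far e k u v, so
   the default value u of the selection plays no role there. *)
Definition outlier (T : finType) (e : rel T) (k : nat) (u : T) : T :=
  odflt u [pick v | far e k u v].

Definition is_order (T : finType) (f : T -> T) (u : T) (s : nat) : bool :=
  [&& 0 < s, iter s f u == u
    & [forall t : 'I_s, (0 < t) ==> (iter t f u != u)]].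

(* For r > 0, a divisor s of r satisfies s <= r, which justifies the bound. *)
Definition order_dvd (T : finType) (f : T -> T) (r : nat) : {set T} :=
  [set u | [exists s : 'I_r.+1, is_order f u s && (s %| r)]].

Lemma is_orderE (T : finType) (f : T -> T) (u : T) (s : nat) :
  injective f -> is_order f u s = (s == order f u).
Proof.
move=> injf; apply/idP/eqP => [/and3P[s0 /eqP fs /forallP min_s] | ->].
  apply/eqP; rewrite eqn_leq; apply/andP; split; last first.
    rewrite leqNgt; apply/negP => lt_s.
    have := findex_iter lt_s; rewrite fs findex0 => s_eq.
    by rewrite -s_eq in s0.
  rewrite leqNgt; apply/negP => lt_s.
  have /implyP/(_ (order_gt0 f u)) := min_s (Ordinal lt_s).
  by rewrite /= iter_order ?eqxx.
rewrite /is_order order_gt0 iter_order // eqxx /=.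
apply/forallP => t; apply/implyP => t0; apply/negP => /eqP ft.
have := findex_iter (ltn_ord t); rewrite ft findex0 => t_eq.
by rewrite -t_eq in t0.
Qed.

Definition induced (T : finType) (e : rel T) (S : {set T}) :
    rel {x : T | x \in S} :=
  fun x y => e (val x) (val y).

Definition isomorphic (T1 T2 : finType) (e1 : rel T1) (e2 : rel T2) : Prop :=
  exists2 phi : T1 -> T2, bijective phi
    & forall x y, e2 (phi x) (phi y) = e1 x y.

Definition dicycle (n : nat) : rel 'I_n := fun i j => j == ordS i.

(* Main.v *)
(** Let A be the adjacency matrix of G, so that I + A + ... + A^k = J - P with P
    the matrix of the outlier function o.  If some in-degree exceeded d, then
    A (J - P) would have equal rows, as for a Moore digraph; the eigenvalues of A
    other than d would be 0 and (k+1)-th roots of unity, whose k-th powers are their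
    conjugates, so tr A = tr A^k = 0 would give d = d^k.  So G is diregular, P is a permutation matrix
    and A P = P A.

    The set of fixed vertices of the automorphism o^r is closed under o and under the
    unique short walks between its vertices, so its adjacency matrix B satisfies
    I + B + ... + B^k = J - Q with Q a permutation matrix commuting with B.  Hence
    B J = J B: the induced digraph is diregular, of degree d' say.  Degree 0 gives a
    transposition, degree 1 a (k+2)-cycle, and degree 2 is impossible: there, weights
    +1 and -1 that alternate along the arcs of a binary tree show that the outlier
    of a vertex is its sibling or, if k <= 3, a parent of it or an out-neighbour of its
    sibling; each case yields two short walks with the same ends. *)

Require Import Defs.
From mathcomp Require Import all_boot.
From mathcomp Require Import all_order all_algebra.
From mathcomp Require Import zify ring.
Set Implicit Arguments.
Unset Strict Implicit.
Unset Printing Implicit Defensive.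

(** * A trace identity for matrices of finite order *)

Section Trace.
Import Order.TTheory GRing.Theory Num.Theory.
Local Open Scope ring_scope.

Lemma mulmx_tr_eq0 (R : realFieldType) n (x : 'rV[R]_n) : x *m x^T = 0 -> x = 0.
Proof.
move/matrixP/(_ 0 0); rewrite !mxE => /eqP.
rewrite psumr_eq0 => [/allP x0|i _]; last by rewrite mxE -expr2 sqr_ge0.
apply/rowP => i; have := x0 i (mem_index_enum _).
by rewrite !mxE mulf_eq0 orbb => /eqP.
Qed.

(* The form Q = sum_i (D^i)^T D^i is definite and invariant under D, so
   D^T = Q D^-1 Q^-1. *)
Lemma trace_finite_order (R : realFieldType) n m (D : 'M[R]_n) :
  D ^+ m.+1 = 1 -> \tr D = \tr (D ^+ m).
Proof.
move=> Dm; pose Q := \sum_(i < m.+1) (D ^+ i)^T *m D ^+ i.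
(* Multiplying by [D^T] and [D] raises each index by one; [D ^+ m.+1 = 1] turns the last term into
   the first. *)
have QD : D^T *m Q *m D = Q.
  rewrite /Q mulmx_sumr mulmx_suml big_ord_recr big_ord_recl /= addrC.
  rewrite expr0 trmx1 mulmx1; congr (_ + _).
    by rewrite mulmxA -trmx_mul -mulmxA -[D ^+ m *m D]exprSr Dm trmx1 mulmx1.
  apply: eq_bigr => i _; rewrite mulmxA -trmx_mul -mulmxA.
  by rewrite -[_ *m D]exprSr.
have uQ : Q \in unitmx.
  rewrite -row_free_unit; apply/inj_row_free => x xQ; apply: mulmx_tr_eq0.
  have : x *m Q *m x^T = 0 by rewrite xQ mul0mx.
  rewrite /Q mulmx_sumr mulmx_suml => /matrixP/(_ 0 0); rewrite summxE mxE.
  pose y i := x *m (D ^+ i)^T.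
  rewrite (eq_bigr (fun i : 'I__ => (y i *m (y i)^T) 0 0)); last first.
    by move=> i _; rewrite /y trmx_mul trmxK !mulmxA.
  move/eqP; rewrite psumr_eq0 => [/allP y0|i _]; last first.
    by rewrite mxE sumr_ge0 // => j _; rewrite [_^T _ _]mxE -expr2 sqr_ge0.
  (* The term of index 0 alone, [x x^T], forces [x = 0]. *)
  have := y0 ord0 (mem_index_enum _); rewrite /y /= expr0 trmx1 mulmx1 => /eqP x0.
  by apply/matrixP => a b; rewrite !ord1 x0 mxE.
have DT : D^T = Q *m D ^+ m *m invmx Q.
  rewrite -{1}QD -!mulmxA [D *m (_ *m _)]mulmxA -[D *m D ^+ m]exprS Dm.
  by rewrite mul1mx mulmxV ?mulmx1.
by rewrite -mxtrace_tr DT mxtrace_mulC mulmxA mulVmx // mul1mx.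
Qed.

(** The idempotent [F = 1 - B ^+ k.+2] annihilates [B] on both sides, so the positive powers of
    [B + F] are [B ^+ m.+1 + F]. Hence [B + F] has finite order, and the trace of [F] cancels. *)
Lemma trace_quasi_finite_order (R : realFieldType) n k (B : 'M[R]_n) :
  B ^+ k.+3 = B -> \tr B = \tr (B ^+ k.+1).
Proof.
move=> Bk; pose F := 1 - B ^+ k.+2.
have BF : B * F = 0 by rewrite mulrBr mulr1 -exprS Bk subrr.
have FB : F * B = 0 by rewrite mulrBl mul1r -exprSr Bk subrr.
have FBm m : F * B ^+ m.+1 = 0 by rewrite exprS mulrA FB mul0r.
have FF : F * F = F by rewrite {2}/F mulrBr mulr1 FBm subr0.
have FE : B ^+ k.+2 + F = 1 by rewrite /F addrC subrK.
clearbody F.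
have DE m : (B + F) ^+ m.+1 = B ^+ m.+1 + F.
  elim: m => [|m IH]; first by rewrite !expr1.
  by rewrite exprS IH mulrDl !mulrDr -exprS BF FBm FF addr0 add0r.
have /trace_finite_order : (B + F) ^+ k.+2 = 1 by rewrite DE.
by rewrite DE !mxtraceD => /addIr.
Qed.

(* Here w is the common row sum of W = A + ... + A^(k+2).  With the idempotent
   E = W / w, A E = E A = d E, the matrix B = A - d E satisfies
   B^(k+3) = B, tr B = -d and tr B^(k+1) = -d^(k+1). *)
Lemma powers_sum_rank1 n d k (A : 'M[rat]_n) (q : 'rV[rat]_n) :
  (0 < n)%N -> (1 < d)%N -> (0 < k)%N ->
  A *m const_mx 1 = d%:R *: const_mx 1 :> 'cV_n ->
  \sum_(i < k.+2) A ^+ i.+1 = const_mx 1 *m q ->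
  (forall i, (i <= k)%N -> \tr (A ^+ i.+1) = 0) -> False.
Proof.
move=> n0 d2 k2 Ac Wq trA; set c := const_mx 1 in Ac Wq.
set W := \sum_(i < _) _ in Wq; pose w : rat := \sum_(i < k.+2) d%:R ^+ i.+1.
have d0 : 0 < d%:R :> rat by rewrite ltr0n; lia.
have w0 : w != 0.
  rewrite gt_eqF // /w big_ord_recl ltr_wpDr // ?expr1 //.
  by apply: sumr_ge0 => i _; rewrite exprn_ge0 // ltW.
have Ac_exp i : A ^+ i *m c = d%:R ^+ i *: c.
  elim: i => [|i IH]; first by rewrite !expr0 mul1mx scale1r.
  by rewrite exprSr -mulmxA Ac -scalemxAr IH scalerA -exprS.
have Wc : W *m c = w *: c.
  by rewrite mulmx_suml scaler_suml; apply: eq_bigr => i _; apply: Ac_exp.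
have qc : q *m c = w%:M.
  apply/matrixP => a b; rewrite !ord1; move: Wc.
  rewrite Wq -mulmxA [q *m c]mx11_scalar mul_mx_scalar.
  move/matrixP/(_ (Ordinal n0) 0); rewrite !mxE !mulr1 => ->.
  by rewrite eqxx.
have trW : \tr W = w by rewrite Wq mxtrace_mulC qc mxtrace_scalar.
have mxZl a (X Y : 'M[rat]_n) : (a *: X) * Y = a *: (X * Y) by apply/esym/scalemxAl.
have mxZr a (X Y : 'M[rat]_n) : X * (a *: Y) = a *: (X * Y) by apply/esym/scalemxAr.
pose E := w^-1 *: W.
have AE : A * E = d%:R *: E.
  by rewrite /E mxZr -[A * W]/(A *m W) Wq mulmxA Ac -scalemxAl !scalerA mulrC.
have AW : A * W = W * A.
  rewrite mulr_sumr mulr_suml; apply: eq_bigr => i _; by rewrite -exprS -exprSr.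
have EA : E * A = d%:R *: E by rewrite -AE mxZl -AW -mxZr.
have WW : W * W = w *: W.
  rewrite -[W * W]/(W *m W) {1 2}Wq mulmxA -[X in X *m _]mulmxA qc.
  by rewrite mul_mx_scalar -scalemxAl -Wq.
have EE : E * E = E.
  by rewrite mxZl mxZr WW scalerK.
have trE : \tr E = 1 by rewrite mxtraceZ trW mulVf.
have WE : W = w *: E by rewrite scalerA mulfV // scale1r.
clearbody E.
have AmE m : A ^+ m * E = d%:R ^+ m *: E.
  elim: m => [|m IH]; first by rewrite !expr0 mul1r scale1r.
  by rewrite exprSr -mulrA AE mxZr IH scalerA -exprS.
pose B := A - d%:R *: E.
have BE m : B ^+ m.+1 = A ^+ m.+1 - d%:R ^+ m.+1 *: E.
  elim: m => [|m IH]; first by rewrite !expr1.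
  rewrite exprSr IH /B mulrBl !mulrBr.
  rewrite [A ^+ _ * (_ *: _)]mxZr AmE !mxZl [E * (_ *: _)]mxZr EA EE.
  by rewrite !scalerA -exprSr -exprS -exprSr subrr subr0.
(* The sum telescopes; [telw] is the same identity for row sums. *)
have telA : A * W - W = A ^+ k.+3 - A.
  rewrite {1}/W big_ord_recr /W [X in _ - X]big_ord_recl /= mulrDr -exprS mulr_sumr expr1.
  rewrite (eq_bigr (fun i : 'I_k.+1 => A ^+ (bump 0 i).+1)) => [|i _]; last by rewrite -exprS.
  by rewrite [X in _ - X]addrC opprD addrACA subrr add0r.
have telw : d%:R * w - w = d%:R ^+ k.+3 - d%:R.
  rewrite {1}/w big_ord_recr /w [X in _ - X]big_ord_recl /= mulrDr -exprS mulr_sumr expr1.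
  rewrite (eq_bigr (fun i : 'I_k.+1 => d%:R ^+ (bump 0 i).+1)) => [|i _]; last first.
    by rewrite -exprS.
  by ring.
have /trace_quasi_finite_order : B ^+ k.+3 = B.
  rewrite BE; have -> : A ^+ k.+3 = A + (A * W - W) by rewrite telA addrC subrK.
  rewrite WE mxZr AE scalerA -scalerBl [w * _]mulrC telw scalerBl.
  by rewrite /B -addrA; congr (_ + _); rewrite addrAC subrr add0r.
rewrite BE -[in LHS](expr1 B) BE !mxtraceD !linearN /= !mxtraceZ trE !trA //.
rewrite !mulr1 !add0r => /oppr_inj/eqP; rewrite -!natrX eqr_nat => /eqP dk.
have : (d ^ 1 < d ^ k.+1)%N by rewrite ltn_exp2l.
by rewrite dk ltnn.
Qed.

End Trace.

(** * Counting walks *)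

Lemma sum_nat_le1 (I : finType) (P : pred I) (F : I -> nat) :
  (forall i, P i -> F i <= 1) ->
  (forall i j, P i -> P j -> 0 < F i -> 0 < F j -> i = j) ->
  \sum_(i | P i) F i <= 1.
Proof.
move=> F1 Finj; case: (pickP [pred i | P i & 0 < F i]) => [i /andP[/= Pi Fi]|F0].
  rewrite (bigD1 i) //= big1 ?addn0 ?F1 // => j /andP[Pj ji].
  by apply/eqP; rewrite -leqn0 leqNgt; apply: contra ji => Fj; apply/eqP; apply: Finj.
by rewrite big1 // => i Pi; have /= := F0 i; rewrite Pi /=; case: (F i).
Qed.

Lemma sum_eq_indic (I : finType) (P : pred I) (j : I) :
  \sum_(i | P i) (i == j) = P j.
Proof.
case Pj: (P j).
  by rewrite (bigD1 j) //= eqxx big1 // => i /andP[_ /negPf->].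
by rewrite big1 // => i Pi; case: eqP Pi Pj => // -> ->.
Qed.

Section Walks.
Variables (T : finType) (e : rel T).

(** The entries of A^m, as natural numbers, for the adjacency matrix A. *)
Fixpoint nwalks (m : nat) (u v : T) : nat :=
  if m is m'.+1 then \sum_(w | e u w) nwalks m' w v else (u == v).

(** The entries of I + A + ... + A^k. *)
Definition ball (k : nat) (u v : T) : nat := \sum_(m < k.+1) nwalks m u v.

Definition indeg (v : T) : nat := #|[set u | e u v]|.

Lemma outdegE u : outdeg e u = \sum_(w | e u w) 1.
Proof. by rewrite sum1_card /outdeg cardsE. Qed.

Lemma indegE v : indeg v = \sum_(w | e w v) 1.
Proof. by rewrite sum1_card /indeg cardsE. Qed.

Lemma nwalksSr m u v : nwalks m.+1 u v = \sum_(w | e w v) nwalks m u w.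
Proof.
elim: m u => [|m IH] u.
  rewrite /= sum_eq_indic (eq_bigr (fun w => (w == u) : nat)) ?sum_eq_indic // => w _.
  by rewrite eq_sym.
by rewrite [LHS]/= (eq_bigr _ (fun w _ => IH w)) exchange_big.
Qed.

Lemma nwalks_walk m u v : (0 < nwalks m u v) = [exists p : m.-tuple T, walk e u v p].
Proof.
elim: m u => [|m IH] u /=.
  rewrite lt0b; apply/eqP/existsP => [->|[p]].
    by exists [tuple]; rewrite /walk /= eqxx.
  by rewrite tuple0 /walk /= => /eqP.
rewrite lt0n sum_nat_eq0 negb_forall; apply/existsP/existsP => [[w]|[p]].
  rewrite negb_imply -lt0n IH => /andP[uw /existsP[p wp]].
  by exists [tuple of w :: p]; rewrite /walk /= uw.
case: (tupleP p) => w q; rewrite /walk /= -andbA => /andP[uw wq]; exists w.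
by rewrite uw /= -lt0n IH; apply/existsP; exists q.
Qed.

Lemma nwalks_le1 m u v :
  (forall p q, walk e u v p -> walk e u v q -> size p = m -> size q = m -> p = q) ->
  nwalks m u v <= 1.
Proof.
elim: m u => [|m IH] u H /=; first by case: (u == v).
apply: sum_nat_le1 => [w uw|w x uw ux].
  apply: IH => p q wp wq sp sq.
  by have [] : w :: p = w :: q; [apply: H; rewrite /walk /= ?uw ?sp ?sq | ].
rewrite !nwalks_walk => /existsP[p wp] /existsP[q xq].
by have [] : w :: p = x :: q; [apply: H; rewrite /walk /= ?uw ?ux ?size_tuple | ].
Qed.

Lemma ball_le1 k u v : geodetic e k -> ball k u v <= 1.
Proof.
move=> geo; apply: sum_nat_le1 => [m _|m l _ _].
  apply: nwalks_le1 => p q wp wq sp sq; apply: geo wp wq _ _;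
  by rewrite ?sp ?sq -ltnS.
rewrite !nwalks_walk => /existsP[p wp] /existsP[q wq]; apply: val_inj => /=.
rewrite -(size_tuple p) -(size_tuple q); congr size.
by apply: geo wp wq _ _; rewrite size_tuple -ltnS.
Qed.

Lemma farE k u v : far e k u v = (ball k u v == 0).
Proof.
rewrite /ball sum_nat_eq0 /far negb_exists; apply: eq_forallb => m /=.
by rewrite -nwalks_walk -leqNgt leqn0.
Qed.

Lemma ballS k u v : ball k.+1 u v = ball k u v + nwalks k.+1 u v.
Proof. by rewrite /ball big_ord_recr. Qed.

Lemma ballSl k u v : ball k.+1 u v = (u == v) + \sum_(w | e u w) ball k w v.
Proof. by rewrite /ball big_ord_recl /= exchange_big. Qed.

Lemma ballSr k u v : ball k.+1 u v = (u == v) + \sum_(w | e w v) ball k u w.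
Proof.
rewrite /ball big_ord_recl; congr (_ + _).
by rewrite [RHS]exchange_big; apply: eq_bigr => i _; rewrite -nwalksSr.
Qed.

(** The matrix A commutes with I + A + ... + A^k: splitting off the first or the last arc of a walk
    gives the same count. *)
Lemma ball_comm k u v :
  \sum_(w | e u w) ball k w v = \sum_(w | e w v) ball k u w.
Proof. by apply: (@addnI (u == v)); rewrite -ballSl -ballSr. Qed.

Lemma nwalks_le_ball m k u v : m <= k -> nwalks m u v <= ball k u v.
Proof.
by rewrite -ltnS => mk; rewrite /ball (bigD1 (Ordinal mk)) //= leq_addr.
Qed.

Lemma nwalks_trans m u v w : e v w -> nwalks m u v <= nwalks m.+1 u w.
Proof. by move=> vw; rewrite nwalksSr (bigD1 v) //= leq_addr. Qed.

Lemma nwalksS_le m u v w : e u v -> nwalks m v w <= nwalks m.+1 u w.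
Proof. by move=> uv /=; rewrite (bigD1 v) //= leq_addr. Qed.

Lemma sum_nwalks_ge d m u : (forall w, d <= outdeg e w) -> d ^ m <= \sum_v nwalks m u v.
Proof.
move=> deg; elim: m u => [|m IH] u.
  by rewrite /= (eq_bigr (fun v => (v == u) : nat)) ?sum_eq_indic // => v _; rewrite eq_sym.
rewrite /= exchange_big expnS /=.
apply: (@leq_trans (\sum_(w | e u w) d ^ m)); last by apply: leq_sum => w _; apply: IH.
by rewrite sum_nat_const leq_mul2r -[#|_|]cardsE deg orbT.
Qed.

Lemma sum_nwalks_outreg d m u : (forall w, outdeg e w = d) -> \sum_v nwalks m u v = d ^ m.
Proof.
move=> deg; elim: m u => [|m IH] u.
  by rewrite /= (eq_bigr (fun v => (v == u) : nat)) ?sum_eq_indic // => v _; rewrite eq_sym.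
rewrite /= exchange_big expnS /= (eq_bigr _ (fun w _ => IH w)).
by rewrite sum_nat_const -[#|_|]cardsE -/(outdeg e u) deg.
Qed.

Lemma sum_nwalks_inreg d m v : (forall w, indeg w = d) -> \sum_u nwalks m u v = d ^ m.
Proof.
move=> deg; elim: m v => [|m IH] v; first by rewrite sum_eq_indic.
rewrite (eq_bigr _ (fun u _ => nwalksSr m u v)) exchange_big expnS /=.
by rewrite (eq_bigr _ (fun w _ => IH w)) sum_nat_const -[#|_|]cardsE -/(indeg v) deg.
Qed.

Lemma sum_ball_outreg d k u : (forall w, outdeg e w = d) -> \sum_v ball k u v = moore d k.
Proof.
by move=> deg; rewrite exchange_big; apply: eq_bigr => m _; apply: sum_nwalks_outreg.
Qed.

Lemma sum_ball_inreg d k v : (forall w, indeg w = d) -> \sum_u ball k u v = moore d k.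
Proof.
by move=> deg; rewrite exchange_big; apply: eq_bigr => m _; apply: sum_nwalks_inreg.
Qed.

Lemma sum_indeg_outdeg : \sum_v indeg v = \sum_u outdeg e u.
Proof.
rewrite (eq_bigr _ (fun v _ => indegE v)) [RHS](eq_bigr _ (fun u _ => outdegE u)).
by rewrite (exchange_big_dep xpredT).
Qed.

(* A vertex of out-degree d + 1 would reach M(d,k) + M(d,k-1) > M(d,k) + 1 vertices. *)
Lemma excess_outreg d k :
  2 <= d -> 2 <= k -> excess_one e d k -> forall u, outdeg e u = d.
Proof.
move=> d2 k2 [geo [mind _] cardT] u; apply/eqP; rewrite eqn_leq mind andbT leqNgt.
apply/negP => du.
case: k k2 geo cardT => // k k1 geo cardT.
have le_n : \sum_v ball k.+1 u v <= #|T|.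
  by rewrite -sum1_card; apply: leq_sum => v _; apply: ball_le1.
have ge_n : 1 + d.+1 * moore d k <= \sum_v ball k.+1 u v.
  rewrite exchange_big big_ord_recl /=; apply: leq_add.
    by rewrite /= (eq_bigr (fun v => (v == u) : nat)) ?sum_eq_indic // => v _; rewrite eq_sym.
  rewrite /moore big_distrr /=; apply: leq_sum => i _.
  rewrite exchange_big /=; apply: (@leq_trans (\sum_(w | e u w) d ^ i)).
    by rewrite sum_nat_const leq_mul2r -[#|_|]cardsE du orbT.
  by apply: leq_sum => w _; apply: sum_nwalks_ge.
have mooreS : moore d k.+1 = 1 + d * moore d k.
  rewrite /moore big_ord_recl expn0 big_distrr /=; congr (_ + _).
  by apply: eq_bigr => i _; rewrite -expnS.
have moore2 : 1 + d <= moore d k.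
  case: k {geo cardT le_n ge_n mooreS} k1 => // k _.
  by rewrite /moore !big_ord_recl /= expn1; lia.
move: (leq_trans ge_n le_n); rewrite cardT mooreS mulSn; lia.
Qed.

(* A (d,k;+1)-digraph satisfies I + A + ... + A^k = J - P, with P the 0-1 matrix
   of the outlier function. *)
Lemma excess_ball d k :
  2 <= d -> 2 <= k -> excess_one e d k ->
  forall u v, ball k u v + (v == outlier e k u) = 1.
Proof.
move=> d2 k2 G; have reg := excess_outreg d2 k2 G; case: G => geo _ cardT u.
have b1 v : ball k u v <= 1 by apply: ball_le1.
(* Of the M(d,k) + 1 vertices, M(d,k) are reached, each once. *)
have sum_far : \sum_v (ball k u v == 0) = 1.
  apply: (@addnI (\sum_v ball k u v)).
  rewrite -big_split /= (sum_ball_outreg _ _ reg) addn1 -cardT -sum1_card.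
  by apply: eq_bigr => v _; have := b1 v; lia.
have [w far_w] : exists w, ball k u w == 0.
  apply/existsP; apply: contraT; rewrite negb_exists => /forallP far0.
  by move: sum_far; rewrite big1 // => v _; rewrite (negPf (far0 v)).
have far_uniq v : (ball k u v == 0) = (v == w).
  apply/idP/eqP => [far_v|-> //]; apply/eqP; apply: contraT => vw.
  by move: sum_far; rewrite (bigD1 w) //= (bigD1 v) //= far_w far_v.
have -> : outlier e k u = w.
  rewrite /outlier; case: pickP => [v|/(_ w)]; rewrite farE ?far_w //.
  by rewrite far_uniq => /eqP.
by move=> v; rewrite -far_uniq; have := b1 v; lia.
Qed.

Lemma nwalks_pair_le_ball k i j u v :
  i != j -> i <= k -> j <= k -> nwalks i u v + nwalks j u v <= ball k u v.
Proof.
rewrite -!(ltnS _ k) => ij ik jk; rewrite /ball (bigD1 (Ordinal ik)) //=.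
by rewrite leq_add2l (bigD1 (Ordinal jk)) 1?eq_sym //= leq_addr.
Qed.

Lemma nwalks0 u : nwalks 0 u u = 1. Proof. by rewrite /= eqxx. Qed.

Lemma nwalks1 u v : nwalks 1 u v = e u v.
Proof.
by rewrite /= sum_eq_indic.
Qed.

Lemma nwalks2_gt0 u v w : e u v -> e v w -> 0 < nwalks 2 u w.
Proof. by move=> uv vw; apply: leq_trans (nwalksS_le 1 w uv); rewrite nwalks1 vw. Qed.

(** * Forbidden configurations of short walks *)

Section Geodetic.
Variable k : nat.
Hypotheses (k2 : 1 < k) (b1 : forall u v, ball k u v <= 1).

Lemma geodetic_irrefl u : e u u = false.
Proof.
apply/negP => uu; have := nwalks_pair_le_ball u u (isT : 0 != 1) (leq0n k) (ltnW k2).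
by rewrite nwalks0 nwalks1 uu => /leq_trans/(_ (b1 u u)).
Qed.

Lemma geodetic_no_shortcut u v w : e u v -> e v w -> e u w = false.
Proof.
move=> uv vw; apply/negP => uw.
have := nwalks_pair_le_ball u w (isT : 1 != 2) (ltnW k2) k2.
rewrite nwalks1 uw => /leq_trans/(_ (b1 u w)).
by have := nwalks2_gt0 uv vw; case: (nwalks 2 u w).
Qed.

Lemma geodetic_midpoint u v v' w : e u v -> e v w -> e u v' -> e v' w -> v = v'.
Proof.
move=> uv vw uv' v'w; apply/eqP; apply: contraT => vv'.
have := leq_trans (nwalks_le_ball u w k2) (b1 u w).
have -> : nwalks 2 u w = \sum_(x | e u x) nwalks 1 x w by [].
rewrite (eq_bigr _ (fun x _ => nwalks1 x w)) (bigD1 v) //= (bigD1 v') /= ?uv' 1?eq_sym //.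
by rewrite vw v'w.
Qed.

End Geodetic.

(** * Powers and traces of the adjacency matrix *)

Section AdjacencyMatrix.
Import GRing.Theory.
Local Open Scope ring_scope.

Let A : 'M[rat]_#|T| := \matrix_(i, j) (e (enum_val i) (enum_val j))%:R.

Let sumT (F : T -> rat) : \sum_(x : T) F x = \sum_(l < #|T|) F (enum_val l).
Proof. by rewrite -(big_enum_val F); apply: eq_bigl. Qed.

Lemma adjacency_exp m i j : (A ^+ m) i j = (nwalks m (enum_val i) (enum_val j))%:R.
Proof.
elim: m i => [|m IH] i; first by rewrite expr0 !mxE /= (inj_eq enum_val_inj).
rewrite exprS mxE /= natr_sum [RHS]big_mkcond sumT; apply: eq_bigr => l _.
by rewrite IH mxE; case: (e _ _); rewrite ?mul1r ?mul0r.
Qed.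

Lemma trace_adjacency_exp k m :
  (forall u v, ball k u v <= 1)%N -> (m < k)%N -> \tr (A ^+ m.+1) = 0.
Proof.
move=> b1 mk; apply: big1 => i _; rewrite adjacency_exp.
have := nwalks_pair_le_ball (enum_val i) (enum_val i) (isT : 0 != m.+1)%N (leq0n k) mk.
rewrite nwalks0 => /leq_trans/(_ (b1 _ _)).
by case: (nwalks m.+1 _ _).
Qed.

(** If A + ... + A^(k+1) has equal rows, it has the rank-one form that [powers_sum_rank1] excludes;
    the traces vanish because there are no short closed walks. *)
Lemma outer_balls_not_constant d k q :
  (0 < #|T|)%N -> (1 < d)%N -> (1 < k)%N ->
  (forall u, outdeg e u = d) -> (forall u v, ball k u v <= 1)%N ->
  (forall u v, \sum_(w | e u w) ball k w v = q v)%N -> False.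
Proof.
(* The new [k] is one less than the old one, which matches the exponents in [powers_sum_rank1]. *)
move=> n0 d2; case: k => // k k1 deg b1 qE.
apply: (@powers_sum_rank1 _ d k A (\row_j (q (enum_val j))%:R)) => //.
- apply/colP => i; rewrite !mxE mulr1.
  rewrite -(expn1 d) -(sum_nwalks_outreg 1 (enum_val i) deg) natr_sum sumT.
  by apply: eq_bigr => j _; rewrite !mxE mulr1 nwalks1.
- apply/matrixP => i j; rewrite summxE !mxE big_ord1 !mxE mul1r.
  rewrite -(qE (enum_val i)) exchange_big natr_sum.
  by apply: eq_bigr => m _; rewrite adjacency_exp.
by move=> m mk; apply: (trace_adjacency_exp b1).
Qed.
End AdjacencyMatrix.

Lemma ball_outlier_le1 k (o : T -> T) :
  (forall u v, ball k u v + (v == o u) = 1) -> forall u v, ball k u v <= 1.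
Proof. by move=> bo u v; rewrite -(bo u v) leq_addr. Qed.

(* The entries of A (J - P) = (J - P) A. *)
Lemma indeg_outlier k (o : T -> T) u v :
  (forall u v, ball k u v + (v == o u) = 1) ->
  indeg v + \sum_(w | e u w) (v == o w) = outdeg e u + e (o u) v.
Proof.
move=> bo.
have outE : outdeg e u = \sum_(w | e u w) ball k w v + \sum_(w | e u w) (v == o w).
  by rewrite outdegE -big_split; apply: eq_bigr => w _; rewrite /= bo.
have inE : indeg v = \sum_(w | e w v) ball k u w + e (o u) v.
  rewrite -(sum_eq_indic (fun w => e w v)) indegE -big_split.
  by apply: eq_bigr => w _; rewrite /= bo.
by rewrite outE inE ball_comm addnAC.
Qed.

(** In matrix terms: P is a permutation matrix, A P = P A and I + A + ... + A^k = J - P. Neither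
    degree nor order is mentioned, so the property can pass to an induced digraph whose degree is
    not yet known. *)
Definition has_outlier (k : nat) (o : T -> T) : Prop :=
  [/\ injective o, forall u v, e (o u) (o v) = e u v
    & forall u v, ball k u v + (v == o u) = 1].

(** In [indeg_outlier] at [u] and [o v] the degrees cancel, which leaves A P = P A. *)
Lemma injective_outlier_aut k (o : T -> T) :
  injective o -> (forall u v, ball k u v + (v == o u) = 1) ->
  (forall u v, outdeg e u = indeg v) ->
  has_outlier k o.
Proof.
move=> oI bo reg; split=> // u v; have := indeg_outlier u (o v) bo.
rewrite -(reg u) => /addnI; rewrite (eq_bigr (fun w => (w == v) : nat)).
  by rewrite sum_eq_indic; case: (e u v); case: (e _ _).
by move=> w _; rewrite (inj_eq oI) eq_sym.
Qed.

(* If some v0 had in-degree above d, then every outlier o u would be adjacent to v0,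
   so no outlier could be adjacent to another one; hence A P, and with it A (J - P),
   would have equal rows, as in a Moore digraph. *)
Lemma outreg_inreg d k (o : T -> T) :
  1 < d -> 1 < k -> (forall u, outdeg e u = d) ->
  (forall u v, ball k u v + (v == o u) = 1) -> forall v, indeg v = d.
Proof.
move=> d1 k1 deg bo.
have b1 := ball_outlier_le1 bo.
have ideg u v : indeg v + \sum_(w | e u w) (v == o w) = d + e (o u) v.
  by rewrite (indeg_outlier u v bo) deg.
have le_d v0 : indeg v0 <= d.
  rewrite leqNgt; apply/negP => v0d.
  have ov0 u : e (o u) v0.
    by have := ideg u v0; case: (e (o u) v0) => // E; move: v0d; rewrite -(addn0 d) -E; lia.
  have ooF u w : e (o u) (o w) = false.
    by apply/negP => oo; have := geodetic_no_shortcut k1 b1 oo (ov0 w); rewrite ov0.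
  (* The common row: if [v] is an outlier, no [o u] is adjacent to it and column [v] of A P is
     constantly [d - indeg v]; otherwise that column is zero. *)
  apply: (@outer_balls_not_constant d k
    (fun v => if v \in codom o then indeg v else d)) => //.
  - by apply/card_gt0P; exists v0.
  move=> u v; have : \sum_(w | e u w) ball k w v + \sum_(w | e u w) (v == o w) = d.
    by rewrite -(deg u) outdegE -big_split; apply: eq_bigr => w _; rewrite /= bo.
  case: ifP => [/codomP[w ->]|vo].
    by have := ideg u (o w); rewrite ooF; lia.
  rewrite [X in _ + X]big1 ?addn0 // => w _; case: eqP => // vE.
  by rewrite vE codom_f in vo.
move=> v; apply/eqP; rewrite eqn_leq le_d /= leqNgt; apply/negP => vd.
have : \sum_v indeg v < \sum_(v : T) d.
  rewrite (bigD1 v) //= [X in _ < X](bigD1 v) //= -addSn leq_add //.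
  by apply: leq_sum => w _.
by rewrite sum_indeg_outdeg (eq_bigr _ (fun u _ => deg u)) ltnn.
Qed.

(** By in-regularity each column of I + ... + A^k sums to M(d,k), one less than the order, so an
    outlier has only one preimage. *)
Lemma excess_has_outlier d k :
  1 < d -> 1 < k -> excess_one e d k -> has_outlier k (outlier e k).
Proof.
move=> d1 k1 G; have deg := excess_outreg d1 k1 G; have bo := excess_ball d1 k1 G.
have ideg := outreg_inreg d1 k1 deg bo; case: G => geo _ cardT.
apply: injective_outlier_aut => // [u w ouw|u v]; last by rewrite deg ideg.
have : \sum_x ball k x (outlier e k u) + \sum_x (outlier e k u == outlier e k x) = #|T|.
  by rewrite -big_split -sum1_card; apply: eq_bigr => x _; rewrite /= bo.
rewrite (sum_ball_inreg _ _ ideg) cardT => E.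
apply/eqP; apply: contraT => uw; move: E.
rewrite (bigD1 u) //= eqxx (bigD1 w) 1?eq_sym //= ouw eqxx; lia.
Qed.

(** * Regularity and order from the outlier permutation *)

Section HasOutlier.
Variables (k : nat) (o : T -> T).
Hypothesis H : has_outlier k o.

Lemma outlier_inj : injective o. Proof. by case: H. Qed.
Lemma outlier_aut u v : e (o u) (o v) = e u v. Proof. by case: H. Qed.
Lemma ball_outlier u v : ball k u v + (v == o u) = 1. Proof. by case: H. Qed.
Let bo := ball_outlier.
Lemma ball_at_most1 u v : ball k u v <= 1.
Proof. exact: ball_outlier_le1. Qed.

Lemma outlier_irrefl u : (u == o u) = false.
Proof.
have := bo u u; have := nwalks_le_ball u u (leq0n k); rewrite nwalks0; lia.
Qed.

(** Since [o] preserves arcs, everything but the degrees cancels in [indeg_outlier]; as [u] and [v]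
    are independent, all degrees agree. *)
Lemma outlier_diregular u v : outdeg e u = indeg v.
Proof.
have := indeg_outlier u v bo; rewrite -(f_invF outlier_inj v) outlier_aut.
rewrite (eq_bigr (fun w => (w == invF outlier_inj v) : nat)).
  by rewrite sum_eq_indic; lia.
by move=> w _; rewrite (inj_eq outlier_inj) eq_sym.
Qed.

Lemma outlier_card d u : outdeg e u = d -> #|T| = (moore d k).+1.
Proof.
move=> du; have deg w : outdeg e w = d by rewrite -du !(outlier_diregular _ u).
have o1 : \sum_v (v == o u) = 1 by rewrite sum_eq_indic.
rewrite -addn1 -(sum_ball_outreg k u deg) -{}o1 -big_split.
by rewrite -sum1_card; apply: eq_bigr => v _; rewrite /= bo.
Qed.

End HasOutlier.

End Walks.

(** * No digraph of degree two *)

Section AlternatingSums.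
Import Order.TTheory GRing.Theory Num.Theory.
Local Open Scope ring_scope.

(* Sum of an alternating weight 1, -1, 1, ... over the complete binary tree of
   depth m. *)
Fixpoint alt_tree (m : nat) : int := if m is m'.+1 then 1 - 2 * alt_tree m' else 1.

Lemma alt_tree_odd m : exists c : int, alt_tree m = 1 + 2 * c.
Proof. by case: m => [|m]; [exists 0 | exists (- alt_tree m); rewrite /=; lia]. Qed.

(** The values run 1, -1, 3, -5, 11, ...; the map x -> 1 - 2x exchanges the two alternatives. *)
Lemma alt_tree_bound m : alt_tree m.+1 <= -1 \/ 3 <= alt_tree m.+1.
Proof. by elim: m => [|m]; rewrite /=; lia. Qed.

Lemma alt_tree_norm i m : (i < m)%N ->
  `|alt_tree i| < `|alt_tree m| \/ i = 0%N /\ m = 1%N.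
Proof.
elim: m => // m IH; rewrite ltnS leq_eqVlt => /predU1P[->|/IH{}IH].
  by case: m {IH} => [|m]; [right | left; have := alt_tree_bound m; rewrite /=; lia].
left; case: IH => [|[-> ->]] //; case: m => [|m]; first by rewrite /=; lia.
by have := alt_tree_bound m; rewrite /=; lia.
Qed.

Lemma alt_tree_eq1 m : `|alt_tree m| = 1 -> (m <= 1)%N.
Proof. by case: m => [|[|m]] //; have := alt_tree_bound m; rewrite /=; lia. Qed.

(** By linearity the sum is that of a tree of depth [K] with root value [t 0], plus that of a tree
    whose root value [g] enters at level [j.+1]. *)
Lemma perturbed_alt_sum (t : nat -> int) (g : int) j K :
  (forall i, (i < K)%N -> t i.+1 = - 2 * t i + (i == j)%:Z * g) ->
  \sum_(i < K.+1) t i =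
  t 0%N * alt_tree K + (if (j < K)%N then g * alt_tree (K - j.+1) else 0).
Proof.
elim: K => [|K IH] tS; first by rewrite big_ord1 /= mulr1 addr0.
have sum_eq : (\sum_(i < K.+1) (val i == j)%:Z * g = if (j <= K)%N then g else 0)%R.
  case: leqP => jK; last first.
    apply: big1 => i _; case: eqP => [ij|]; rewrite ?mul0r //.
    by have := ltn_ord i; rewrite -[nat_of_ord i]/(val i) ij ltnS leqNgt jK.
  rewrite -ltnS in jK; rewrite (bigD1 (Ordinal jK)) //= eqxx mul1r big1 ?addr0 // => i.
  by rewrite -val_eqE /= => /negPf->; rewrite mul0r.
rewrite big_ord_recl.
rewrite (eq_bigr (fun i : 'I_K.+1 => - 2 * t i + (val i == j)%:Z * g)); last first.
  by move=> i _; rewrite -tS.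
rewrite big_split -mulr_sumr IH => [|i iK]; last by apply: tS; lia.
rewrite /= sum_eq ltnS subSS; case: ltngtP => jK; last by rewrite jK subnn /=; ring.
  have -> : (K - j = (K - j.+1).+1)%N by lia.
  by rewrite /=; ring.
by ring.
Qed.

Lemma big_pair (R : Type) (idx : R) (op : Monoid.com_law idx) (I : finType)
    (P : pred I) (F : I -> R) a b :
  a != b -> P =1 pred2 a b -> \big[op/idx]_(i | P i) F i = op (F a) (F b).
Proof.
move=> ab PE; rewrite (bigD1 a) ?PE /= ?eqxx // (bigD1 b) ?PE /=; last first.
  by rewrite eqxx orbT eq_sym.
rewrite big_pred0 ?Monoid.mulm1 // => i; rewrite PE /=.
by case: (i == a); case: (i == b).
Qed.

Lemma pred2_exhaust (I : eqType) (c d a b x : I) :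
  a != b -> pred2 c d a -> pred2 c d b -> pred2 c d x -> x = a \/ x = b.
Proof.
by move=> /negP ab /pred2P[]E /pred2P[]F /pred2P[]->; subst; auto; case: ab.
Qed.

Lemma card2_pred2 (I : finType) (P : pred I) : #|[set x | P x]| = 2%N ->
  exists a b, a != b /\ P =1 pred2 a b.
Proof.
move=> /eqP/cards2P[a [b [ab E]]]; exists a, b; split=> // x.
by have /setP/(_ x) := E; rewrite !inE.
Qed.

Lemma sum_indic_mul (I : finType) (c : I) (f : I -> int) : \sum_x (x == c)%:Z * f x = f c.
Proof.
rewrite (bigD1 c) //= eqxx mul1r big1 ?addr0 // => x /negPf->.
by rewrite mul0r.
Qed.

End AlternatingSums.

Section DegreeTwo.
Import Order.TTheory GRing.Theory Num.Theory.
Local Open Scope ring_scope.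
Variables (T : finType) (e : rel T).
Local Notation nwalks := (nwalks e).
Local Notation ball := (ball e).
Local Notation indeg := (indeg e).
Variables (k : nat) (o : T -> T).
Hypotheses (H : has_outlier e k o) (k2 : (1 < k)%N) (deg : forall u, outdeg e u = 2%N).

Lemma ideg v : indeg v = 2%N. Proof. by rewrite -(outlier_diregular H v). Qed.

Lemma out_pair u : exists a b, a != b /\ e u =1 pred2 a b.
Proof. exact: card2_pred2 (deg u). Qed.

Lemma out_pairP u a b x : a != b -> e u a -> e u b -> e u x -> x = a \/ x = b.
Proof. by have [c [d [_ uE]]] := out_pair u; rewrite !uE; apply: pred2_exhaust. Qed.

Lemma in_pairP v a b x : a != b -> e a v -> e b v -> e x v -> x = a \/ x = b.
Proof.
have [c [d [_ vE]]] := card2_pred2 (P := e^~ v) (ideg v).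
by rewrite !(vE _ : e _ v = _); apply: pred2_exhaust.
Qed.

(* The vertices at distance k from u2 are split by the sign according to whether they
   are reached through u5 or through u6; both kinds are equally numerous, and adjacent
   ones have opposite signs.  As they contain almost all of the binary tree of depth
   k - 1 below u1, on which alternating sums are large, z = o u2 must be close to u1. *)
Section Siblings.
Variables (K : nat) (u u1 u2 u5 u6 : T).
Hypothesis kE : k = K.+1.
Hypotheses (u12 : u1 != u2) (uE : e u =1 pred2 u1 u2).
Hypotheses (u56 : u5 != u6) (u2E : e u2 =1 pred2 u5 u6).

Let z := o u2.
Let sign x : int := (nwalks K u5 x)%:Z - (nwalks K u6 x)%:Z.
(* This value at z, where sign vanishes, extends the alternation along arcs to z. *)
Let sign' x : int := sign x + (x == z)%:Z * sign (o u).
Let mid x := nwalks k u2 x = 1%N.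

Lemma arc_u_u1 : e u u1. Proof. by rewrite uE /= eqxx. Qed.
Lemma arc_u_u2 : e u u2. Proof. by rewrite uE /= eqxx orbT. Qed.
Lemma arc_u2_u5 : e u2 u5. Proof. by rewrite u2E /= eqxx. Qed.
Lemma arc_u2_u6 : e u2 u6. Proof. by rewrite u2E /= eqxx orbT. Qed.

Lemma arc_neq a b : e a b -> a != b.
Proof.
by move=> ab; apply/eqP => E; rewrite E (geodetic_irrefl k2 (ball_at_most1 H)) in ab.
Qed.

(* The vertices at distance exactly k from u2 are u, o u and the ball of radius
   k - 1 around u1, with z = o u2 removed. *)
Lemma nwalks_sphere x :
  (nwalks k u2 x + (x == z) = (x == o u) + (x == u) + ball K u1 x)%N.
Proof.
have := ball_outlier H u x; have := ball_outlier H u2 x.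
rewrite kE ballS ballSl (big_pair _ _ u12 uE) /=.
by rewrite -/z [u == x]eq_sym; lia.
Qed.

Lemma mid_split x : nwalks k u2 x = (nwalks K u5 x + nwalks K u6 x)%N.
Proof. by rewrite kE /= (big_pair _ _ u56 u2E). Qed.

Lemma nwalks_excl v x : (nwalks K v x + nwalks k v x <= 1)%N.
Proof.
by apply: leq_trans (ball_at_most1 H v x); apply: nwalks_pair_le_ball; rewrite ?kE //; lia.
Qed.

(** A walk of length [K] from [u5] to [x] extends to one of length [k] to [y], which excludes a walk
    of length [K] from [u5] to [y]; likewise for [u6]. *)
Lemma sign_alt x y : e x y -> mid x -> mid y -> sign y = - sign x.
Proof.
rewrite /mid /sign !mid_split => xy.
have := nwalks_excl u5 y; have := nwalks_excl u6 y; rewrite kE.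
have := nwalks_trans K u5 xy; have := nwalks_trans K u6 xy; lia.
Qed.

Lemma sign_mid x : mid x -> sign x = 1 \/ sign x = -1.
Proof. by rewrite /mid /sign mid_split; lia. Qed.

Lemma mid_le1 x : (nwalks k u2 x <= 1)%N.
Proof. by have := nwalks_excl u2 x; lia. Qed.

Lemma not_mid_z : nwalks k u2 z = 0%N.
Proof. by have := ball_outlier H u2 z; rewrite eqxx kE ballS; lia. Qed.

Lemma sign_z : sign z = 0.
Proof. by have := mid_split z; rewrite not_mid_z /sign; lia. Qed.

Lemma ou_z : (o u == z) = false.
Proof. by rewrite (inj_eq (outlier_inj H)) (negPf (arc_neq arc_u_u2)). Qed.

Lemma mid_ou : mid (o u).
Proof.
rewrite /mid; have := nwalks_sphere (o u); have := mid_le1 (o u).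
by rewrite ou_z eqxx; lia.
Qed.

(** Injectivity of [o] puts [z] within distance k of [u5] and of [u6], but not within k - 1, as [u2]
    does not reach it. So each has exactly one walk of length k to [z], and these walks end through
    in-neighbours of [z]. *)
Lemma sum_sign_preds_z : \sum_(x | e x z) sign x = 0.
Proof.
have at_k v : e u2 v -> nwalks k v z = 1%N.
  move=> u2v; have := ball_outlier H v z; have := ball_outlier H u2 z.
  rewrite eqxx kE ballSl (bigD1 v) //=.
  have : (z == o v) = false by rewrite (inj_eq (outlier_inj H)) (negPf (arc_neq u2v)).
  by move=> ->; rewrite ballS /=; lia.
by rewrite sumrB -!(big_morph Posz PoszD (erefl _)) -!nwalksSr -kE !at_k ?arc_u2_u5 ?arc_u2_u6.
Qed.

Lemma in_ball x : (0 < ball K u1 x)%N -> [/\ x != z -> mid x, x != o u & ball K u1 x = 1%N].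
Proof.
have := nwalks_sphere x; have := mid_le1 x; have := ball_at_most1 H u1 x.
rewrite {1}kE ballS /mid; case: eqP => [->|_] b1x mx st bx; split=> //.
- by apply/eqP => E; move: st; rewrite -E eqxx not_mid_z /=; lia.
- by lia.
- by move=> _; lia.
- by apply/eqP => E; move: st; rewrite -E eqxx; lia.
by lia.
Qed.

(** The new case is [y = z]: its in-neighbours are [x] and [o u], whose signs sum to 0, and
    [sign' z = sign (o u)]. *)
Lemma sign'_alt x y : (0 < ball K u1 x)%N -> (0 < ball K u1 y)%N -> x != z -> e x y ->
  sign' y = - sign' x.
Proof.
move=> bx by_ xz xy; have [/(_ xz) mx xou _] := in_ball bx.
have [my you _] := in_ball by_; rewrite /sign' (negPf xz) mul0r addr0.
case: eqP => [yz|/eqP/my my']; last by rewrite mul0r addr0; apply: sign_alt.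
have ouz : e (o u) z by rewrite (outlier_aut H) arc_u_u2.
have := sum_sign_preds_z.
rewrite (big_pair _ _ xou) => [|w].
  by rewrite yz sign_z mul1r add0r /= => /eqP; rewrite addrC addr_eq0 => /eqP.
apply/idP/pred2P => [wz|[]->]; rewrite -?yz //; last by rewrite yz.
by apply: in_pairP wz; rewrite -?yz // yz.
Qed.

Lemma sum_sign : \sum_x sign x = 0.
Proof.
by rewrite sumrB -!(big_morph Posz PoszD (erefl _)) !(sum_nwalks_outreg _ _ deg) subrr.
Qed.

(** The total sign is 0 and is carried by the vertices at distance k from [u2], which
    [nwalks_sphere] splits into [o u], [u] and the ball. *)
Lemma sum_ball_sign : \sum_x (ball K u1 x)%:Z * sign x = - sign (o u) - sign u.
Proof.
have signE x : sign x =
    (x == o u)%:Z * sign x + (x == u)%:Z * sign x + (ball K u1 x)%:Z * sign x.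
  rewrite -!mulrDl -!PoszD -nwalks_sphere; case: eqP => [->|_]; first by rewrite sign_z mulr0.
  have := mid_split x; have := mid_le1 x; rewrite addn0 /sign.
  case: (nwalks k u2 x) => [|[|//]] _; last by rewrite mul1r.
  by case: (nwalks K u5 x) (nwalks K u6 x) => [|?] [|?].
have := sum_sign; rewrite (eq_bigr _ (fun x _ => signE x)) !big_split !sum_indic_mul /=.
by move/eqP; rewrite addrC addr_eq0 opprD => /eqP.
Qed.

Lemma sum_ball_sign' :
  \sum_x (ball K u1 x)%:Z * sign' x = (ball K u1 z)%:Z * sign (o u) - sign (o u) - sign u.
Proof.
have -> : \sum_x (ball K u1 x)%:Z * sign' x =
    \sum_x (ball K u1 x)%:Z * sign x + \sum_x (x == z)%:Z * ((ball K u1 x)%:Z * sign (o u)).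
  rewrite -big_split; apply: eq_bigr => x _; rewrite /= /sign'; ring.
by rewrite sum_ball_sign sum_indic_mul; ring.
Qed.

(** The defect at [z] of the rule that the values at the two out-neighbours of a vertex sum to minus
    twice its own value. *)
Let g : int := \sum_(y | e z y) sign' y + 2 * sign' z.

Let level (i : nat) : int := \sum_x (nwalks i u1 x)%:Z * sign' x.

Lemma nwalks_ball i x : (i <= K)%N -> (0 < nwalks i u1 x)%N -> (0 < ball K u1 x)%N.
Proof. by move=> iK /leq_trans; apply; apply: nwalks_le_ball. Qed.

Lemma level0 : level 0 = sign' u1.
Proof.
rewrite /level (eq_bigr (fun x => (x == u1)%:Z * sign' x)) ?sum_indic_mul // => x _.
by rewrite /= eq_sym.
Qed.

Lemma levelS i : (i < K)%N -> level i.+1 = - 2 * level i + (nwalks i u1 z)%:Z * g.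
Proof.
move=> iK; have sign'_out x : (0 < nwalks i u1 x)%N ->
    \sum_(y | e x y) sign' y = - 2 * sign' x + (x == z)%:Z * g.
  move=> ix; case: eqP => [->|/eqP xz]; first by rewrite mul1r /g; ring.
  rewrite mul0r addr0 (eq_bigr (fun=> - sign' x)) => [|y xy].
    by have [a [b [ab xE]]] := out_pair x; rewrite (big_pair _ _ ab xE) /=; ring.
  apply: sign'_alt => //; first exact: nwalks_ball (ltnW iK) ix.
  by apply: nwalks_ball iK _; apply: leq_trans ix (nwalks_trans i u1 xy).
have -> : (nwalks i u1 z)%:Z * g = \sum_x (x == z)%:Z * ((nwalks i u1 x)%:Z * g).
  by rewrite sum_indic_mul.
rewrite /level mulr_sumr -big_split /=.
transitivity (\sum_x (nwalks i u1 x)%:Z * \sum_(y | e x y) sign' y).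
  under [RHS]eq_bigr => x _ do rewrite mulr_sumr.
  rewrite (exchange_big_dep xpredT) //=; apply: eq_bigr => y _.
  rewrite -mulr_suml -(big_morph Posz PoszD (erefl _)) -nwalksSr //.
apply: eq_bigr => x _; case: (posnP (nwalks i u1 x)) => [->|/sign'_out->].
  by rewrite !mul0r !mulr0 addr0.
by ring.
Qed.

Lemma sum_level :
  \sum_(i < K.+1) level i = (ball K u1 z)%:Z * sign (o u) - sign (o u) - sign u.
Proof.
rewrite -sum_ball_sign' exchange_big; apply: eq_bigr => x _.
by rewrite -mulr_suml -(big_morph Posz PoszD (erefl _)).
Qed.

Lemma K_gt0 : (0 < K)%N. Proof. by rewrite -ltnS -kE. Qed.

Lemma u1_in_ball : (0 < ball K u1 u1)%N.
Proof. by apply: leq_trans (nwalks_le_ball e u1 u1 (leq0n K)); rewrite nwalks0. Qed.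

Lemma sign'_u1 : u1 != z -> sign' u1 = 1 \/ sign' u1 = -1.
Proof.
move=> u1z; rewrite /sign' (negPf u1z) mul0r addr0.
by have [/(_ u1z)/sign_mid] := in_ball u1_in_ball.
Qed.

(** Two evaluations of the sum of the levels are compared, [sum_level] and [perturbed_alt_sum]; the
    depth of [z] below [u1], if any, locates the perturbation. *)
Lemma sibling_outlier_dichotomy :
  [\/ z = u1, k = 3%N /\ e u1 z | k = 2%N /\ z = u].
Proof.
have [-> | u1z] := eqVneq z u1; [by constructor 1|rewrite eq_sym in u1z].
have [bz|bz] := posnP (ball K u1 z).
  have zu : z = u.
    by have := nwalks_sphere z; rewrite bz not_mid_z eqxx [z == o u]eq_sym ou_z; case: eqP.
  constructor 3; split=> //.
  have nz i : (i <= K)%N -> nwalks i u1 z = 0%N.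
    by move=> iK; apply/eqP; rewrite -leqn0 -bz nwalks_le_ball.
  (* The index [K.+1] is out of range: nothing is perturbed. *)
  have lev i : (i < K)%N -> level i.+1 = - 2 * level i + (i == K.+1)%:Z * g.
    by move=> iK; rewrite levelS // nz ?(ltnW iK) // (_ : (i == K.+1) = false) //; lia.
  have := perturbed_alt_sum lev.
  rewrite sum_level bz -[in sign u]zu sign_z level0 ltnNge leqnSn /= => E.
  have aK : `|alt_tree K| = 1.
    by case: (sign_mid mid_ou) E => ->; case: (sign'_u1 u1z) => ->; lia.
  by rewrite kE; have := alt_tree_eq1 aK; lia.
have [_ zou bz1] := in_ball bz.
have [j [jK nj]] : exists j, (j <= K)%N /\ forall i, (i <= K)%N -> nwalks i u1 z = (i == j).
  have : (0 < ball K u1 z)%N := bz.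
  rewrite lt0n /ball sum_nat_eq0 negb_forall => /existsP[j]; rewrite -lt0n => nj.
  exists j; split=> [|i iK]; first by rewrite -ltnS.
  have le1 l : (l <= K)%N -> (nwalks l u1 z <= 1)%N.
    by move=> lK; rewrite -bz1 nwalks_le_ball.
  have jK : (j <= K)%N by rewrite -ltnS.
  have [->|ij] := eqVneq i j; first by have := le1 j jK; lia.
  by have := nwalks_pair_le_ball e u1 z ij iK jK; rewrite bz1; lia.
have zu : z != u.
  by apply/eqP => E; move: (nwalks_sphere z); rewrite not_mid_z eqxx bz1 E eqxx; lia.
have mid_u : mid u.
  by have := nwalks_sphere u; have := mid_le1 u; rewrite /mid eqxx eq_sym (negPf zu); lia.
have su : sign u = - sign' u1.
  rewrite /sign' (negPf u1z) mul0r addr0; have [/(_ u1z) mu1 _ _] := in_ball u1_in_ball.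
  by rewrite (sign_alt arc_u_u1 mid_u mu1) opprK.
have j0 : (0 < j)%N.
  rewrite lt0n; apply/eqP => j0; have := nj 0%N isT; rewrite j0 /= => /eqP.
  by rewrite (negPf u1z).
have lev i : (i < K)%N -> level i.+1 = - 2 * level i + (i == j)%:Z * g.
  by move=> iK; rewrite levelS // nj // ltnW.
have := perturbed_alt_sum lev.
rewrite sum_level bz1 mul1r subrr sub0r su opprK level0.
(* At the last depth the perturbation comes too late, so [alt_tree K = 1]; but then [K = 1], where
   the value is -1. *)
case: ltnP => [jK'|Kj] E; last first.
  have /alt_tree_eq1 K1 : `|alt_tree K| = 1 by case: (sign'_u1 u1z) E => ->; lia.
  by case: (sign'_u1 u1z) E => ->; rewrite (_ : K = 1%N) /=; lia.
have sign'_child y : e z y -> sign' y = 1 \/ sign' y = -1.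
  move=> zy; have yz : y != z by rewrite eq_sym arc_neq.
  rewrite /sign' (negPf yz) mul0r addr0; apply: sign_mid.
  have zj : (0 < nwalks j u1 z)%N by rewrite nj // eqxx.
  have /in_ball[/(_ yz)//] : (0 < ball K u1 y)%N.
  by apply: (nwalks_ball jK'); apply: leq_trans zj (nwalks_trans j u1 zy).
(* Two signs plus twice a sign: an even number of absolute value at most 4. *)
have gE : exists h, g = 2 * h /\ (`|h| = 1 \/ h = 0 \/ `|h| = 2).
  have [a [b [ab zE]]] := out_pair z.
  have za : e z a by rewrite zE /= eqxx.
  have zb : e z b by rewrite zE /= eqxx orbT.
  rewrite /g (big_pair _ _ ab zE) [sign' z]/sign' eqxx sign_z mul1r add0r /=.
  case: (sign'_child a za) => ->; case: (sign'_child b zb) => ->;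
    case: (sign_mid mid_ou) => ->.
  - by exists 2; clear; lia.
  - by exists 0; clear; lia.
  - by exists 1; clear; lia.
  - by exists (-1); clear; lia.
  - by exists 1; clear; lia.
  - by exists (-1); clear; lia.
  - by exists 0; clear; lia.
  - by exists (-2); clear; lia.
have [h [gh hN]] := gE.
have K0 := K_gt0; have KE : K = K.-1.+1 by rewrite prednK.
have E2 : sign' u1 * alt_tree K.-1 = h * alt_tree (K.-1 - j).
  move: E; rewrite [in alt_tree K]KE (_ : (K - j.+1 = K.-1 - j)%N); last by lia.
  rewrite gh /=; set A := alt_tree _; set B := alt_tree _ => E.
  have : 2 * (sign' u1 * A - h * B) = 0.
    rewrite [LHS](_ : _ = sign' u1 - (sign' u1 * (1 - 2 * A) + 2 * h * B)); last by ring.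
    by rewrite -E subrr.
  by move/eqP; rewrite mulf_eq0 /= subr_eq0 => /eqP.
have normE : `|alt_tree K.-1| = `|h| * `|alt_tree (K.-1 - j)|.
  by rewrite -normrM -E2 normrM; case: (sign'_u1 u1z) => ->; rewrite ?normrN normr1 mul1r.
have [c cE] := alt_tree_odd K.-1.
(* The left side is odd, so only [h] of absolute value 1 survives. *)
have norm_eq : `|alt_tree K.-1| = `|alt_tree (K.-1 - j)|.
  by move: normE; case: hN => [->|[->|->]]; rewrite ?normr0 ?mul1r // cE; lia.
(* The only tie in absolute value is between depths 0 and 1, so [K = 2] and [j = 1]. *)
have [|lt_norm|[Kj0 K1]] := @alt_tree_norm (K.-1 - j) K.-1; first by lia.
  by rewrite norm_eq ltxx in lt_norm.
have j1 : j = 1%N by lia.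
constructor 2; split; first by lia.
by have := nj j jK; rewrite eqxx j1 nwalks1; case: (e u1 z).
Qed.

End Siblings.
Lemma sibling_outlier p a b : a != b -> e p a -> e p b ->
  [\/ o b = a, k = 3%N /\ e a (o b) | k = 2%N /\ o b = p].
Proof.
move=> ab pa pb; have [c [d [cd bE]]] := out_pair b.
apply: (@sibling_outlier_dichotomy k.-1 p a b c d) => // [|x]; first by rewrite prednK // ltnW.
by apply/idP/pred2P => [|[]->] //; apply: out_pairP ab pa pb.
Qed.

Lemma other_out p w : e p w -> exists2 w', w' != w & e p w'.
Proof.
have [a [b [ab pE]]] := out_pair p; rewrite pE => /pred2P[]->.
  by exists b; rewrite 1?eq_sym // pE /= eqxx orbT.
by exists a; rewrite // pE /= eqxx.
Qed.

Lemma other_in p w : e p w -> exists2 p', p' != p & e p' w.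
Proof.
have [a [b [ab wE]]] := card2_pred2 (P := e^~ w) (ideg w).
have {}wE x : e x w = pred2 a b x := wE x; rewrite wE => /pred2P[]->.
  by exists b; rewrite 1?eq_sym // wE /= eqxx orbT.
by exists a; rewrite // wE /= eqxx.
Qed.

Lemma no_arc_outlier p : e p (o p) = false.
Proof.
have := ball_outlier H p (o p); have := nwalks_le_ball e p (o p) (ltnW k2).
by rewrite nwalks1 eqxx; case: (e _ _) => //; lia.
Qed.

Lemma neq_outlier p : p != o p.
Proof. by rewrite (outlier_irrefl H). Qed.

(* Vertices with the same out-neighbours miss the same pair of vertices, hence
   are each other's outlier. *)
Lemma twins_outlier p p' w w' : p != p' -> w != w' ->
  e p w -> e p w' -> e p' w -> e p' w' -> o w = w'.
Proof.
move=> pp' ww' pw pw' p'w p'w'.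
have eE x : e p x = e p' x.
  apply/idP/idP => [px|p'x]; first by case: (out_pairP ww' pw pw' px) => ->.
  by case: (out_pairP ww' p'w p'w' p'x) => ->.
have op' : o p = p'.
  have := ball_outlier H p p'; have := ball_outlier H p' p'.
  rewrite -(prednK (ltnW k2)) !ballSl (eq_bigl _ _ eE) eqxx (negPf pp').
  by rewrite (negPf (neq_outlier p')) => Ep'; case: eqP => [//|_]; lia.
have := outlier_aut H p w; rewrite pw op' => p'ow.
case: (out_pairP ww' p'w p'w' p'ow) => // E.
by have := neq_outlier w; rewrite E eqxx.
Qed.

(** The arc from [w] to [c'] is mapped to one from [w'] to [c], so [x0] reaches [c] through both [w]
    and [w']. *)
Lemma siblings_not_swapped (x0 : T) :
  (forall p a b, a != b -> e p a -> e p b -> o b = a) -> False.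
Proof.
move=> sib; have [w [w' [ww' pE]]] := out_pair x0.
have [c [c' [cc' wE]]] := out_pair w.
have wc : e w c by rewrite wE /= eqxx.
have wc' : e w c' by rewrite wE /= eqxx orbT.
have pw : e x0 w by rewrite pE /= eqxx.
have pw' : e x0 w' by rewrite pE /= eqxx orbT.
have ow : o w = w' by apply: sib pw' pw; rewrite eq_sym.
have oc' : o c' = c by apply: sib wc wc'.
have := outlier_aut H w c'; rewrite ow oc' wc' => w'c.
by have := geodetic_midpoint k2 (ball_at_most1 H) pw wc pw' w'c; apply/eqP.
Qed.

(** * Outliers among the out-neighbours of the sibling, as for k = 3 *)

Section Nephews.
Hypothesis nephew : forall p a b, a != b -> e p a -> e p b -> o b = a \/ e a (o b).

(** If [o w = w'], the in-neighbours of [w'] are [p] and [w''], which forces [o p = w''], [o p' = p]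
    and [o w'' = w]. Then [p'] reaches [o w'] through both [w] and [w'']. *)
Lemma nephew_no_swap p p' w w' w'' : p != p' -> w != w' -> w != w'' -> w' != w'' ->
  e p w -> e p w' -> e p' w -> e p' w'' -> o w <> w'.
Proof.
move=> pp' ww' ww'' w'w'' pw pw' p'w p'w'' ow.
have w''w' : e w'' w'.
  have w''w : w'' != w by rewrite eq_sym.
  case: (nephew w''w p'w'' p'w) => [E|]; last by rewrite ow.
  by move: w'w''; rewrite -E ow eqxx.
have pw'' : p != w''.
  apply/eqP => E; move: p'w''; rewrite -E => p'p.
  by have := geodetic_no_shortcut k2 (ball_at_most1 H) p'p pw; rewrite p'w.
have opw' : e (o p) w' by rewrite -ow (outlier_aut H).
have op'w' : e (o p') w' by rewrite -ow (outlier_aut H).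
have op : o p = w''.
  have [E|//] := in_pairP pw'' pw' w''w' opw'.
  by have := neq_outlier p; rewrite E eqxx.
have op' : o p' = p.
  have [//|E] := in_pairP pw'' pw' w''w' op'w'.
  by move: pp'; rewrite (outlier_inj H (etrans op (esym E))) eqxx.
have ow'' : o w'' = w.
  have pow'' : e p (o w'') by rewrite -op' (outlier_aut H).
  have [//|E] := out_pairP ww' pw pw' pow''.
  by move: ww''; rewrite (outlier_inj H (etrans ow (esym E))) eqxx.
have w''x : e w'' (o w') by rewrite -op (outlier_aut H).
have wx : e w (o w') by rewrite -{1}ow'' (outlier_aut H).
by have := geodetic_midpoint k2 (ball_at_most1 H) p'w wx p'w'' w''x; apply/eqP.
Qed.

(** With swaps excluded, [w'] and [w''] are the in-neighbours of [o w], so [o] maps the parents of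
    [w] onto them; no vertex is adjacent to its own outlier. *)
Lemma nephew_parents p p' w w' w'' : p != p' -> w != w' -> w != w'' -> w' != w'' ->
  e p w -> e p w' -> e p' w -> e p' w'' -> o p = w'' /\ o p' = w'.
Proof.
move=> pp' ww' ww'' w'w'' pw pw' p'w p'w''.
have w'ow : e w' (o w).
  have w'w : w' != w by rewrite eq_sym.
  by case: (nephew w'w pw' pw) => // /(nephew_no_swap pp' ww' ww'' w'w'' pw pw' p'w p'w'').
have w''ow : e w'' (o w).
  have w''w : w'' != w by rewrite eq_sym.
  case: (nephew w''w p'w'' p'w) => // E.
  by case: (@nephew_no_swap p' p w w'' w') => //; rewrite eq_sym.
have op : o p = w''.
  have [E|//] := in_pairP w'w'' w'ow w''ow (etrans (outlier_aut H p w) pw).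
  by have := no_arc_outlier p; rewrite E pw'.
split=> //; have [//|E] := in_pairP w'w'' w'ow w''ow (etrans (outlier_aut H p' w) p'w).
by move: pp'; rewrite (outlier_inj H (etrans op (esym E))) eqxx.
Qed.

(** Unless the second parent of [w] is also one of [w'], [nephew_parents] around both [w] and [w']
    yields walks from [p] to [o (o p)] through both. *)
Lemma nephew_siblings p w w' : w' != w -> e p w -> e p w' -> o w = w'.
Proof.
rewrite eq_sym => ww' pw pw'; have [p' p'p p'w] := other_in pw.
have pp' : p != p' by rewrite eq_sym.
have [w'' w''w p'w''] := other_out p'w; have ww'' : w != w'' by rewrite eq_sym.
have [p'w'|p'w'] := boolP (e p' w'); first exact: twins_outlier pw pw' p'w p'w'.
have w'w'' : w' != w'' by apply: contraNneq p'w' => ->.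
have [op op'] := nephew_parents pp' ww' ww'' w'w'' pw pw' p'w p'w''.
have [p2 p2p p2w'] := other_in pw'; have [x xw' p2x] := other_out p2w'.
have wx : w != x.
  apply: contraNneq p'w' => wx; rewrite -wx in p2x.
  by case: (in_pairP pp' pw p'w p2x) => E; [rewrite E eqxx in p2p | rewrite -E].
have pp2 : p != p2 by rewrite eq_sym.
have w'w : w' != w by rewrite eq_sym.
have w'x : w' != x by rewrite eq_sym.
have [opx op2] := nephew_parents pp2 w'w w'x wx pw' pw p2w' p2x.
have w1 : e w (o (o p)) by rewrite -op2 (outlier_aut H) opx.
have w2 : e w' (o (o p)) by rewrite -op' (outlier_aut H) op.
by move: ww'; rewrite (geodetic_midpoint k2 (ball_at_most1 H) pw w1 pw' w2) eqxx.
Qed.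

End Nephews.

Lemma no_degree_two : ~ (0 < #|T|)%N.
Proof.
case/card_gt0P => x0 _; apply: (siblings_not_swapped x0) => p a b ab pa pb.
have [k3|k3] := eqVneq k 3%N.
  apply: nephew_siblings ab pb pa => {}p {}a {}b ab pa pb.
  by case: (sibling_outlier ab pa pb) => [|[]|[]]; [left|right|rewrite k3].
have [//|[E]|[_ obp]] := sibling_outlier ab pa pb; first by rewrite E in k3.
(* The case [o b = p] is refuted by applying the same trichotomy below the second parent [p'] of
   [b]. *)
have [p' p'p p'b] := other_in pb; have [c cb p'c] := other_out p'b.
have [oc|[]|[_ op']] := sibling_outlier cb p'c p'b.
- have := geodetic_no_shortcut k2 (ball_at_most1 H) p'c; rewrite -oc obp => /(_ b pb).
  by rewrite p'b.
- by move=> k_3; rewrite k_3 in k3.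
by rewrite -op' obp eqxx in p'p.
Qed.

End DegreeTwo.

(** * Degree one and the digraph of fixed vertices *)

Section DegreeOne.
Variables (T : finType) (e : rel T) (k : nat) (o : T -> T) (x0 : T).
Hypotheses (H : has_outlier e k o) (k2 : 1 < k) (deg : forall u, outdeg e u = 1).

(** The arcs form the graph of an injection [f]. Within [k] steps [x0] reaches every vertex but
    [o x0], which must then be the next iterate and lead back to [x0]. *)
Lemma degree_one_dicycle : isomorphic (@dicycle k.+2) e.
Proof.
have b1 := ball_at_most1 H; have bo := ball_outlier H.
have [f fE] : exists f, forall u v, e u v = (v == f u).
  exists (fun u => odflt u [pick v | e u v]) => u v.
  have /eqP/cards1P[w /setP uE] := deg u.
  have {}uE x : e u x = (x == w) by have := uE x; rewrite !inE.
  by case: pickP => [x|/(_ w)]; rewrite uE ?eqxx // => /eqP->; rewrite uE.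
have fI : injective f.
  move=> u w fuw; have : indeg e (f u) = 1 by rewrite -(outlier_diregular H u) deg.
  move/eqP/cards1P => [a /setP aE].
  have {}aE x : f x = f u -> x = a.
    by move=> fx; have := aE x; rewrite !inE fE fx eqxx => /esym/eqP.
  by rewrite (aE u) // (aE w).
have walkE m u v : nwalks e m u v = (v == iter m f u).
  elim: m u => [|m IH] u; first by rewrite /= eq_sym.
  rewrite /= (eq_bigl _ _ (fE u)) big_pred1_eq IH -iterSr //.
have iter_o m : m <= k -> iter m f x0 != o x0.
  move=> mk; apply/eqP => E; have := bo x0 (o x0); have := nwalks_le_ball e x0 (o x0) mk.
  by rewrite walkE E !eqxx; lia.
have iter_neq m l : m < l -> l <= k -> iter m f x0 != iter l f x0.
  move=> ml lk; apply/eqP => E.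
  have := nwalks_pair_le_ball e x0 (iter l f x0) (negbT (ltn_eqF ml))
    (ltnW (leq_trans ml lk)) lk.
  by rewrite !walkE E eqxx => /leq_trans/(_ (b1 _ _)).
have reach v : v != o x0 -> exists2 m, m <= k & v = iter m f x0.
  move=> vo; have := bo x0 v; rewrite (negPf vo) addn0 => b.
  have : 0 < ball e k x0 v by rewrite b.
  rewrite lt0n /ball sum_nat_eq0 negb_forall => /existsP[m].
  by rewrite walkE /= eqb0 negbK => /eqP->; exists m => //; rewrite -ltnS.
have fo : f (o x0) = x0.
  have [|m mk] := reach (f (o x0)).
    by apply/eqP => E; have := geodetic_irrefl k2 b1 (o x0); rewrite fE E eqxx.
  case: m mk => [//|m] mk /fI E.
  by have := iter_o m (ltnW mk); rewrite E eqxx.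
have last_iter : iter k.+1 f x0 = o x0.
  apply/eqP; apply: contraT => /reach[[|m] mk] => [|/fI] E.
    by have := iter_o k (leqnn k); rewrite (fI (iter k f x0) (o x0) (etrans E (esym fo))) eqxx.
  by have /eqP[] := iter_neq m k mk (leqnn k); apply: esym.
pose phi (i : 'I_k.+2) := iter i f x0.
have phiI : injective phi.
  suff neq i j : i < j -> j <= k.+1 -> iter i f x0 != iter j f x0.
    move=> i j E; apply: val_inj => /=; case: (ltngtP i j) => // ij.
      by have := neq _ _ ij (ltn_ord j : j <= k.+1); rewrite -/(phi i) E eqxx.
    by have := neq _ _ ij (ltn_ord i : i <= k.+1); rewrite -/(phi i) E eqxx.
  move=> ij; rewrite leq_eqVlt => /predU1P[jk|]; last exact: iter_neq.
  by rewrite jk last_iter iter_o // -ltnS -jk.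
exists phi => [|i j].
  apply: inj_card_bij => //; rewrite card_ord (outlier_card H (deg x0)).
  rewrite /moore (eq_bigr (fun=> 1)) => [|i _]; last by rewrite exp1n.
  by rewrite sum_nat_const card_ord muln1.
rewrite fE /dicycle -(inj_eq phiI); congr (_ == _); rewrite /phi /=.
have := ltn_ord i; rewrite ltnS leq_eqVlt => /predU1P[->|ik].
  by rewrite modnn -[RHS]fo -last_iter.
by rewrite modn_small.
Qed.

End DegreeOne.

(** * The digraph induced on the fixed vertices of an automorphism *)

Section FixedVertices.
Variables (T : finType) (e : rel T) (k : nat) (o phi : T -> T).
Hypotheses (H : has_outlier e k o) (phiI : injective phi).
Hypothesis phi_aut : forall u v, e (phi u) (phi v) = e u v.
Hypothesis phi_o : forall u, phi (o u) = o (phi u).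
Variable S : {set T}.
Hypothesis SE : forall u, (u \in S) = (phi u == u).

Local Notation eS := (@induced T e S).

Lemma nwalks_aut m u v : nwalks e m (phi u) (phi v) = nwalks e m u v.
Proof.
elim: m u => [|m IH] u /=; first by rewrite (inj_eq phiI).
rewrite (reindex_inj phiI) /=; under eq_bigl => w do rewrite phi_aut.
exact: eq_bigr.
Qed.

(* The unique short walk between two fixed vertices is fixed. *)
Lemma nwalks_induced m (x y : {x | x \in S}) :
  m <= k -> nwalks eS m x y = nwalks e m (val x) (val y).
Proof.
elim: m x => [|m IH] x mk; first by rewrite /= (inj_eq val_inj).
rewrite /= (bigID (mem S)) /= [X in _ = _ + X]big1 ?addn0 => [|w /andP[xw wS]].
  rewrite (eq_bigl (fun w => (w \in S) && e (val x) w)) => [|w]; last by rewrite andbC.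
  by rewrite big_sub_cond; apply: eq_bigr => w _; apply/IH/ltnW.
apply/eqP; rewrite -leqn0 leqNgt; apply: contra wS => wy.
have xS : phi (val x) = val x by apply/eqP; rewrite -SE (valP x).
have yS : phi (val y) = val y by apply/eqP; rewrite -SE (valP y).
rewrite SE; apply: contraT => phiw.
have := leq_trans (nwalks_le_ball e (val x) (val y) mk) (ball_at_most1 H _ _).
rewrite /= (bigD1 w) //= (bigD1 (phi w)) /=; last by rewrite -{1}xS phi_aut xw phiw.
have -> : nwalks e m (phi w) (sval y) = nwalks e m w (sval y).
  by rewrite -{1}[sval y]yS nwalks_aut.
by lia.
Qed.

Lemma outlier_fixed u : u \in S -> o u \in S.
Proof. by rewrite !SE phi_o (inj_eq (outlier_inj H)). Qed.

Definition induced_outlier (x : {x | x \in S}) : {x | x \in S} :=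
  Sub (o (val x)) (outlier_fixed (valP x)).

Lemma induced_has_outlier : has_outlier eS k induced_outlier.
Proof.
split=> [x y /(congr1 val)/(outlier_inj H)/val_inj//|x y|x y].
  by rewrite /induced /= (outlier_aut H).
rewrite -[RHS](ball_outlier H (val x) (val y)); congr (_ + _).
by apply: eq_bigr => m _; apply: nwalks_induced; rewrite -ltnS.
Qed.

Lemma walk_induced (x y : {x | x \in S}) p :
  walk eS x y p = walk e (val x) (val y) (map val p).
Proof.
by rewrite /walk path_map last_map (inj_eq val_inj).
Qed.

Lemma geodetic_induced : geodetic e k -> geodetic eS k.
Proof.
move=> geo x y p q; rewrite !walk_induced => wp wq sp sq.
by apply: (inj_map val_inj); apply: geo wp wq _ _; rewrite size_map.
Qed.

Lemma outdeg_induced (x : {x | x \in S}) : outdeg eS x <= outdeg e (val x).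
Proof.
rewrite /outdeg -(card_imset _ val_inj); apply/subset_leq_card/subsetP => w.
by case/imsetP => y; rewrite !inE => xy ->.
Qed.

End FixedVertices.

(** * Orders of vertices and fixed points of iterates *)

Lemma iter_order_dvd (T : finType) (f : T -> T) n u :
  injective f -> (iter n f u == u) = (order f u %| n).
Proof.
move=> fI; have iterM q : iter (q * order f u) f u = u.
  by elim: q => // q IH; rewrite mulSn iterD IH iter_order.
rewrite {1}(divn_eq n (order f u)) addnC iterD iterM.
apply/eqP/idP => [E|]; last by rewrite /dvdn => /eqP->.
have := findex_iter (ltn_pmod n (order_gt0 f u)); rewrite E findex0 /dvdn => <-.
by [].
Qed.

Lemma order_dvdE (T : finType) (f : T -> T) r u :
  0 < r -> injective f -> (u \in order_dvd f r) = (iter r f u == u).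
Proof.
move=> r0 fI; rewrite inE iter_order_dvd //.
apply/existsP/idP => [[s /andP[]]|ur]; first by rewrite is_orderE // => /eqP->.
have sr : order f u < r.+1 by rewrite ltnS dvdn_leq.
by exists (Ordinal sr); rewrite is_orderE //= eqxx.
Qed.

Theorem corollary9 (T : finType) (e : rel T) (d k r : nat)
  (hd : 2 <= d) (hk : 2 <= k) (hG : excess_one e d k) (hr : 2 <= r) :
  let o := outlier e k in
  let S := order_dvd o r in
  S = [set: T]
  \/ S = set0
  \/ (exists u v : T, [/\ u != v, o u = v, o v = u & S = [set u; v]])
  \/ isomorphic (@dicycle k.+2) (@induced T e S)
  \/ (exists d' : nat,
        [/\ 3 <= d', d' <= d - 1 & excess_one (@induced T e S) d' k]).
Proof.
move=> o S.
have H : has_outlier e k o := excess_has_outlier hd hk hG.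
have oI := outlier_inj H.
have deg := excess_outreg hd hk hG.
have SE u : (u \in S) = (iter r o u == u) by rewrite order_dvdE // ltnW.
have iterI : injective (iter r o) by elim: r {hr S SE} => // r IH u v /oI/IH.
have iter_aut u v : e (iter r o u) (iter r o v) = e u v.
  by elim: r {hr S SE iterI} => //= r <-; rewrite (outlier_aut H).
have iter_o u : iter r o (o u) = o (iter r o u) by rewrite -iterSr.
have HS := induced_has_outlier H iterI iter_aut iter_o SE.
have [S0|[u uS]] := set_0Vmem S; first by right; left.
pose x0 : {x | x \in S} := Sub u uS; pose d' := outdeg (@induced T e S) x0.
have degS x : outdeg (@induced T e S) x = d' by rewrite /d' !(outlier_diregular HS _ x0).
have cardS : #|S| = (moore d' k).+1.
  by rewrite -(outlier_card HS (erefl d')) card_sig; apply: eq_card.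
have le_d : d' <= d by rewrite -(deg u); apply: (outdeg_induced e x0).
have cardT : #|T| = (moore d k).+1 by case: hG.
(* The degree determines the order, so equal degrees give all of [T]. *)
have [d'd|d'd] := eqVneq d' d.
  by left; apply/eqP; rewrite eqEcard subsetT cardsT cardS cardT d'd leqnn.
right; right; have [d3|] := leqP 3 d'.
  right; right; exists d'; split=> //; first by rewrite leq_subRL //; lia.
  split; first by apply: geodetic_induced; case: hG.
    by split=> [x|]; [rewrite degS | exists x0].
  by rewrite (outlier_card HS (erefl d')).
rewrite ltnS leq_eqVlt => /predU1P[d'2|].
  have : 0 < #|{: {x | x \in S}}| by apply/card_gt0P; exists x0.
  by case/(no_degree_two HS hk) => x; rewrite degS.
rewrite ltnS leq_eqVlt => /predU1P[d'1|].
  by right; left; apply: (degree_one_dicycle x0 HS hk) => x; rewrite degS.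
rewrite ltnS leqn0 => /eqP d'0; left.
(* Here M(0,k) = 1, the only nonzero term being 0^0, so [S] has two elements. *)
have SuE : S = [set u; o u].
  apply/esym/eqP; rewrite eqEcard subUset !sub1set uS (outlier_fixed H iter_o SE uS) /=.
  rewrite cards2 (outlier_irrefl H) cardS d'0 /moore big_ord_recl big1 // => i _.
  by rewrite exp0n.
have ooS : o (o u) \in S by rewrite !(outlier_fixed H iter_o SE).
exists u, (o u); split=> //; first by rewrite (outlier_irrefl H).
move: ooS; rewrite SuE !inE [o (o u) == o u]eq_sym (outlier_irrefl H) orbF.
by move/eqP.
Qed.
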